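(* For every positive integer $n$, the generic completion rank of $G(n,n-1)$ is $n-\lfloor\sqrt{n}\rfloor$.
   Context: $G(n,n-1)$ denotes the bipartite graph whose parts are two disjoint copies of $[n]=\{1,\dots,n\}$, where $i$ in the first part is adjacent to every $j\neq i$ in the second part (and not to $i$); that is, the corresponding $n\times n$ partial matrices have exactly the diagonal entries unspecified. For a bipartite graph $G=([n],[n],E)$ with $E\subseteq[n]\times[n]$, a $G$-partial matrix over $\mathbb{C}$ is a vector $M\in\mathbb{C}^E$; a completion of $M$ is an $n\times n$ complex matrix $A$ with $A_{ij}=M_{ij}$ for all $(i,j)\in E$; the complex completion rank of $M$ is the smallest rank of a completion. The generic completion rank of $G$ is the unique integer that is the complex completion rank of all $M$ in some nonempty Zariski-open subset of $\mathbb{C}^E$. *)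

(* Defs.v *)
From mathcomp Require Import all_boot all_order all_algebra.
From mathcomp Require Import reals complex mpoly.

Set Implicit Arguments.
Unset Strict Implicit.
Unset Printing Implicit Defensive.

Import Order.TTheory GRing.Theory Num.Theory.
Local Open Scope ring_scope.

Section Zariski.
Variables (F : fieldType) (I : finType).

(* The affine space F^I is {ffun I -> F}; the variable of index k : 'I_#|I|
   is the coordinate at enum_val k. *)
Definition eval_at (p : {mpoly F[#|I|]}) (x : {ffun I -> F}) : F :=
  p.@[fun k => x (enum_val k)].

Definition zariski_closed (Z : {ffun I -> F} -> Prop) : Prop :=
  exists S : {mpoly F[#|I|]} -> Prop,
    forall x, Z x <-> (forall p, S p -> eval_at p x = 0).

Definition zariski_open (U : {ffun I -> F} -> Prop) : Prop :=
  exists2 Z, zariski_closed Z & forall x, U x <-> ~ Z x.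

End Zariski.

Section Completion.
Variables (F : fieldType) (n : nat).

(* A bipartite graph ([n], [n], E) is given by its edge set E. *)
Implicit Type E : {set 'I_n * 'I_n}.

Definition partial_matrix E : predArgType :=
  {ffun {e : 'I_n * 'I_n | e \in E} -> F}.

Definition completion E (M : partial_matrix E) (A : 'M[F]_n) : Prop :=
  forall e : {e : 'I_n * 'I_n | e \in E}, A (val e).1 (val e).2 = M e.

Definition is_completion_rank E (M : partial_matrix E) (r : nat) : Prop :=
  (exists2 A, completion M A & \rank A = r) /\
  (forall A, completion M A -> (r <= \rank A)%N).

Definition generically_completion_rank E (r : nat) : Prop :=
  exists U : partial_matrix E -> Prop,
    [/\ zariski_open U,
        exists M, U M
      & forall M, U M -> is_completion_rank M r].

Definition is_generic_completion_rank E (r : nat) : Prop :=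
  unique (generically_completion_rank E) r.

End Completion.

(* G(n, n-1) *)
Definition off_diagonal_graph (n : nat) : {set 'I_n * 'I_n} :=
  [set e | e.1 != e.2].

(* Main.v *)
Require Import Defs.
From mathcomp Require Import all_boot all_order all_algebra.
From mathcomp Require Import reals complex mpoly.
From mathcomp Require Import closed_field boolp zify.

Import Order.TTheory GRing.Theory Num.Theory.
Local Open Scope ring_scope.

(** Write k for the integer part of the square root of n, so that
    k^2 <= n < (k+1)^2.  Matrices of corank c have codimension c^2 among all
    n x n matrices, and completing the off-diagonal entries leaves n diagonal
    entries free; corank k should therefore be reachable, and corank k+1 not.
    Both halves of this dimension count are made rigorous with polynomial maps
    into the space of off-diagonal entries.

    Rank at most n - k is reached generically
    ([generic_low_rank_completion]).  Let A be a fixed matrix of rank at most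
    n - k and consider the map sending (U, V) to the off-diagonal part of
    U A V.  By quantifier elimination over an algebraically closed field, the
    image of a polynomial map either contains a nonempty principal open set or
    is contained in a hypersurface ([generic_image]).  The second case is
    excluded as soon as the differential of the map is onto at one point
    ([no_vanishing_on_submersion]); at U = V = 1 this says that every matrix
    has the form U' A + A V' up to a diagonal matrix.  For A = 1 - X Y with
    Y X = 1, where Y is k x n and X is n x k, it is enough that D |-> Y D X
    maps the diagonal matrices onto the k x k matrices, that is, that the n
    products of a column of Y with the corresponding row of X span a space of
    dimension k^2.  Since k^2 <= n, such X and Y exist
    ([diagonal_sandwich_onto]).

    A smaller rank r is generically not reached
    ([generic_completion_outside_rank]).  A matrix of rank r is determined by r
    rows forming a basis of its row space and by the coordinates of the other
    rows in that basis: n^2 - (n - r)^2 parameters on which the entries depend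
    polynomially.  If r < n - k this is less than the number n^2 - n of
    off-diagonal entries, and more polynomials than variables are algebraically
    dependent ([algebraic_dependence]), so that some nonzero polynomial
    vanishes on all partial matrices with a completion of rank r.

    Finally, nonempty open sets of an affine space meet, because a product of
    nonzero polynomials does not vanish everywhere; this combines the two halves
    and yields uniqueness of the generic rank. *)

(** * Polynomials in several variables over an algebraically closed field *)

Lemma base_expansion_inj (D N : nat) (a b : 'I_N -> nat) :
    (forall i, a i < D)%N -> (forall i, b i < D)%N ->
  (\sum_i a i * D ^ i = \sum_i b i * D ^ i)%N -> a =1 b.
Proof.
elim: N a b => [|N IHN] a b aD bD; first by move=> _ [].
have split c : (\sum_(i < N.+1) c i * D ^ i
    = (\sum_(i < N) c (lift ord0 i) * D ^ i) * D + c ord0)%N.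
  rewrite big_ord_recl expn0 muln1 addnC big_distrl /=; congr addn.
  by apply: eq_bigr => i _; rewrite /bump add1n expnS mulnA mulnAC.
rewrite !split => eq_ab.
have D_gt0 : (0 < D)%N by apply: leq_ltn_trans (aD ord0).
have eq0 : a ord0 = b ord0.
  by move: (congr1 (modn^~ D) eq_ab); rewrite !modnMDl !modn_small.
have eqS : (fun i => a (lift ord0 i)) =1 (fun i => b (lift ord0 i)).
  apply: IHN => // ; move: eq_ab; rewrite eq0 => /addIn /eqP.
  by rewrite eqn_pmul2r // => /eqP.
by move=> i; case: (unliftP ord0 i) => [j|] ->; [exact: eqS | exact: eq0].
Qed.

Section Polynomials.
Variables (K : closedFieldType) (N : nat).
Implicit Types (p q : {mpoly K[N]}) (v w : 'I_N -> K).

Lemma closed_poly_nonroot (g : {poly K}) :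
  g != 0 -> exists2 t, t != 0 & g.[t] != 0.
Proof.
move=> g0; have : g * 'X != 0 by rewrite mulf_neq0 // polyX_eq0.
case/closed_nonrootP => t; rewrite rootE hornerM hornerX mulf_eq0 negb_or.
by case/andP=> gt t0; exists t.
Qed.

(** Kronecker substitution: replacing the i-th variable by t ^ (D ^ i), with D
    above all exponents of p, sends distinct monomials of p to distinct powers
    of t, which reduces the claim to polynomials in one variable. *)
Lemma mpoly_nonvanishing p : p != 0 -> exists v, p.@[v] != 0.
Proof.
move=> p0; pose D := msize p.
pose wt (m : 'X_{1..N}) := (\sum_i m i * D ^ i)%N.
have small m : m \in msupp p -> forall i, (m i < D)%N.
  move=> mp i; apply: leq_ltn_trans (msize_mdeg_lt mp).
  by rewrite mdegE (bigD1 i) //= leq_addr.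
have wt_inj : {in msupp p &, injective wt}.
  move=> m m' mp m'p /base_expansion_inj eq_m; apply/mnmP.
  by apply: eq_m; apply: small.
pose g : {poly K} := \sum_(m <- msupp p) p@_m *: 'X^(wt m).
have g0 : g != 0.
  apply/eqP => /(congr1 (fun h : {poly K} => h`_(wt (mlead p)))).
  rewrite coef0 coef_sum (bigD1_seq (mlead p)) ?mlead_supp //= big_seq_cond big1.
    rewrite addr0 coefZ coefXn eqxx mulr1 => /eqP.
    by rewrite mleadc_eq0 (negPf p0).
  move=> m /andP[mp neq_m]; rewrite coefZ coefXn.
  case: eqP => [eq_wt|]; last by rewrite mulr0.
  by rewrite (wt_inj _ _ _ mp eq_wt) ?mlead_supp // eqxx in neq_m.
have [t _ gt] := closed_poly_nonroot g g0.
exists (fun i => t ^+ (D ^ i)); apply: contra gt => /eqP pt.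
apply/eqP; rewrite -[RHS]pt mevalE horner_sum; apply: eq_bigr => m _.
rewrite hornerZ hornerXn; congr (_ * _); rewrite expr_sum.
by apply: eq_bigr => i _; rewrite -exprM mulnC.
Qed.

Lemma exists_translate p v0 : p != 0 ->
  exists2 q, q != 0 & forall v, q.@[v] = p.@[fun i => v0 i + v i].
Proof.
move=> p0.
pose q := p \mPo [tuple ('X_i + (v0 i)%:MP : {mpoly K[N]}) | i < N].
have qE v : q.@[v] = p.@[fun i => v0 i + v i].
  rewrite comp_mpoly_meval; apply: meval_eq => i.
  by rewrite tnth_mktuple mevalD mevalXU mevalC addrC.
exists q => //; apply: contraNneq p0 => q0.
apply/negPn/negP => /mpoly_nonvanishing [v].
suff -> : p.@[v] = 0 by rewrite eqxx.
have <- : q.@[fun i => v i - v0 i] = p.@[v].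
  by rewrite qE; apply: meval_eq => i; rewrite addrC subrK.
by rewrite q0 meval0.
Qed.

(** Along the curve t v + t^2 w the polynomial p is t^d times a polynomial in t
    with constant term p_d(v), where p_d is the homogeneous part of p of lowest
    degree d.  It suffices to choose v with p_d(v) != 0. *)
Lemma lowest_form_nonvanishing p : p != 0 ->
  exists v, forall w, exists t, p.@[fun i => t * v i + t ^+ 2 * w i] != 0.
Proof.
move=> p0.
have [m0 m0p m0_min] : exists2 m0, m0 \in msupp p &
    forall m, m \in msupp p -> (mdeg m0 <= mdeg m)%N.
  by exists (mlast p); [exact: mlast_supp | move=> m /mlast_lemc /lemc_mdeg].
pose d := mdeg m0.
pose low : {mpoly K[N]} := \sum_(m <- msupp p | mdeg m == d) p@_m *: 'X_[m].
have low0 : low != 0.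
  apply/eqP => /(congr1 (mcoeff m0)); rewrite mcoeff0 raddf_sum /= -big_filter.
  rewrite (bigD1_seq m0) ?filter_uniq ?msupp_uniq ?mem_filter ?eqxx //= big1.
    rewrite addr0 mcoeffZ mcoeffX eqxx mulr1 => /eqP.
    by rewrite mcoeff_eq0 m0p.
  by move=> m neq_m; rewrite mcoeffZ mcoeffX (negPf neq_m) mulr0.
have [v lowv] := mpoly_nonvanishing low low0.
exists v => w.
pose g : {poly K} := \sum_(m <- msupp p)
   (p@_m *: ('X^(mdeg m - d) * \prod_i ((v i)%:P + (w i) *: 'X) ^+ m i)).
have g0 : g.[0] = low.@[v].
  rewrite horner_sum raddf_sum /= [RHS]big_mkcond /= [LHS]big_seq [RHS]big_seq.
  apply: eq_bigr => m mp; rewrite hornerZ hornerM hornerXn horner_prod.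
  case: eqP => [->|neq_d].
    rewrite subnn expr0 mul1r mevalZ mevalX; congr (_ * _); apply: eq_bigr => i _.
    by rewrite horner_exp hornerD hornerC hornerZ hornerX mulr0 addr0.
  rewrite expr0n subn_eq0 leqNgt ltn_neqAle m0_min // andbT.
  by rewrite (introN eqP) ?mul0r ?mulr0 // => /esym.
have gE t : p.@[fun i => t * v i + t ^+ 2 * w i] = t ^+ d * g.[t].
  rewrite horner_sum mevalE mulr_sumr big_seq [RHS]big_seq; apply: eq_bigr => m mp.
  rewrite hornerZ hornerM hornerXn horner_prod mulrCA; congr (_ * _).
  rewrite mulrA -exprD subnKC ?m0_min // mdegE expr_sum -big_split /=.
  apply: eq_bigr => i _; rewrite horner_exp hornerD hornerC hornerZ hornerX -exprMn.
  by congr (_ ^+ _); rewrite mulrDr expr2 [w i * t]mulrC mulrA.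
have [t t0 gt] : exists2 t, t != 0 & g.[t] != 0.
  apply: closed_poly_nonroot; apply: contra_neq lowv => eq0.
  by rewrite -g0 eq0 horner0.
by exists t; rewrite gE mulf_neq0 ?expf_neq0.
Qed.

(** If the differential of a quadratic map is onto at a point with image v0, then
    every v is the tangent at v0 of a curve v0 + t v + t^2 w in the image, namely
    the image of a line.  No nonzero polynomial vanishes on all these curves, so
    none vanishes on the image. *)
Lemma no_vanishing_on_submersion p v0 : p != 0 ->
    (forall v, exists w, forall t,
       p.@[fun i => v0 i + (t * v i + t ^+ 2 * w i)] = 0) ->
  False.
Proof.
move=> p0 vanish; have [q q0 qE] := exists_translate p v0 p0.
have [v v_ok] := lowest_form_nonvanishing q q0.
have [w pw] := vanish v; have [t] := v_ok w.
by rewrite qE pw eqxx.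
Qed.

End Polynomials.

(** * Images of polynomial maps *)

Section Constructible.
Variables (K : closedFieldType) (N : nat).
Implicit Types (p q : {mpoly K[N]}) (v : 'I_N -> K) (e : seq K).

(** The valuation of formulas in which the i-th variable takes the value v i for
    i < N; all later variables take the default value 0. *)
Definition env v : seq K := [seq v i | i <- enum 'I_N].

Lemma size_env v : size (env v) = N.
Proof. by rewrite size_map size_enum_ord. Qed.

Lemma nth_env v (i : 'I_N) : (env v)`_i = v i.
Proof.
by rewrite /env (nth_map i) ?size_enum_ord // nth_ord_enum.
Qed.

Lemma mpoly_of_term (t : GRing.term K) : GRing.rterm t ->
  exists p, forall v, GRing.eval (env v) t = p.@[v].
Proof.
elim: t => //=.
- move=> k _; have [kN|Nk] := ltnP k N.
    by exists 'X_(Ordinal kN) => v; rewrite mevalXU -nth_env.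
  by exists 0 => v; rewrite meval0 nth_default ?size_env.
- by move=> c _; exists c%:MP => v; rewrite mevalC.
- by move=> k _; exists (k%:R) => v; rewrite rmorph_nat.
- move=> t1 IH1 t2 IH2 /andP[/IH1[p1 e1] /IH2[p2 e2]].
  by exists (p1 + p2) => v; rewrite mevalD e1 e2.
- by move=> t1 IH1 /IH1[p1 e1]; exists (- p1) => v; rewrite mevalN e1.
- by move=> t1 IH1 k /IH1[p1 e1]; exists (p1 *+ k) => v; rewrite mevalMn e1.
- move=> t1 IH1 t2 IH2 /andP[/IH1[p1 e1] /IH2[p2 e2]].
  by exists (p1 * p2) => v; rewrite mevalM e1 e2.
- by move=> t1 IH1 k /IH1[p1 e1]; exists (p1 ^+ k) => v; rewrite rmorphXn e1.
Qed.

(** An equation between two terms holds either identically, or only on the zero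
    set of a nonzero polynomial; Boolean connectives preserve the property of
    being constant off a hypersurface. *)
Lemma qf_generically_constant (f : GRing.formula K) :
    GRing.qf_form f -> GRing.rformula f ->
  exists2 p, p != 0 &
    exists b, forall v, p.@[v] != 0 -> GRing.qf_eval (env v) f = b.
Proof.
pose constant (F : ('I_N -> K) -> bool) := exists2 p, p != 0 &
  exists b, forall v, p.@[v] != 0 -> F v = b.
have combine (op : bool -> bool -> bool) F G :
    constant F -> constant G -> constant (fun v => op (F v) (G v)).
  move=> [p1 p1n [b1 e1]] [p2 p2n [b2 e2]].
  exists (p1 * p2); first exact: mulf_neq0.
  exists (op b1 b2) => v; rewrite mevalM mulf_eq0 negb_or => /andP[v1 v2].
  by rewrite e1 ?e2.
elim: f => //=.
- by move=> b _ _; exists 1; [exact: oner_neq0 | exists b].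
- move=> t1 t2 _ /andP[/mpoly_of_term[p1 e1] /mpoly_of_term[p2 e2]].
  have [eq12|neq12] := eqVneq p1 p2.
    exists 1; first exact: oner_neq0.
    by exists true => v _; rewrite e1 e2 eq12 eqxx.
  exists (p1 - p2); first by rewrite subr_eq0.
  by exists false => v; rewrite mevalB subr_eq0 e1 e2 => /negPf.
- move=> f1 IH1 f2 IH2 /andP[q1 q2] /andP[r1 r2].
  exact: (combine andb _ _ (IH1 q1 r1) (IH2 q2 r2)).
- move=> f1 IH1 f2 IH2 /andP[q1 q2] /andP[r1 r2].
  exact: (combine orb _ _ (IH1 q1 r1) (IH2 q2 r2)).
- move=> f1 IH1 f2 IH2 /andP[q1 q2] /andP[r1 r2].
  exact: (combine implb _ _ (IH1 q1 r1) (IH2 q2 r2)).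
- move=> f1 IH1 q1 r1; have [p p0 [b eb]] := IH1 q1 r1.
  by exists p => //; exists (~~ b) => v /eb ->.
Qed.

Lemma generically_decided (f : GRing.formula K) : GRing.rformula f ->
  exists2 p, p != 0 &
    (forall v, p.@[v] != 0 -> GRing.holds (env v) f) \/
    (forall v, p.@[v] != 0 -> ~ GRing.holds (env v) f).
Proof.
move=> rf; have wf := @ClosedFieldQE.wf_ex_elim K.
have ok := ClosedFieldQE.holds_ex_elim (@solve_monicpoly K).
have holdsP v := GRing.quantifier_elim_rformP wf ok (env v) rf.
have /andP[qf rqf] := GRing.quantifier_elim_wf wf rf.
have [p p0 [[] eb]] := qf_generically_constant _ qf rqf; exists p => //.
  by left => v /eb ev; apply/holdsP.
by right => v /eb ev; apply/holdsP; rewrite ev.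
Qed.

(** When the quantified variables come right after those of the valuation e,
    their values are just appended to e. *)
Lemma holds_exists_block m (f : GRing.formula K) e :
  GRing.holds e (foldr GRing.Exists f (iota (size e) m)) <->
  exists2 s, size s = m & GRing.holds (e ++ s) f.
Proof.
elim: m e => [|m IHm] e /=.
  split=> [ef|[s /size0nil ->]]; last by rewrite cats0.
  by exists [::] => //; rewrite cats0.
have step x : set_nth 0 e (size e) x = rcons e x.
  by elim: e {IHm} => //= y e ->.
split=> [[x]|[[|x s] //= [sz] ef]].
  rewrite step -[(size e).+1](size_rcons e x) => /IHm[s sz ef].
  by exists (x :: s); rewrite /= ?sz // -cat_rcons.
exists x; rewrite step -[(size e).+1](size_rcons e x); apply/IHm.
by exists s => //; rewrite cat_rcons.
Qed.

Lemma term_of_mpoly m (q : {mpoly K[m]}) :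
  exists2 t : GRing.term K, GRing.rterm t &
    forall v (w : 'I_m -> K) s, (forall i : 'I_m, s`_i = w i) ->
      GRing.eval (env v ++ s) t = q.@[w].
Proof.
elim/mpolyind: q => [|c u q _ _ [t rt et]].
  by exists (GRing.Const 0) => //= v w s _; rewrite meval0.
have [tu rtu etu] : exists2 t : GRing.term K, GRing.rterm t &
    forall v (w : 'I_m -> K) s, (forall i : 'I_m, s`_i = w i) ->
      GRing.eval (env v ++ s) t = \prod_(i < m) w i ^+ u i.
  elim: (index_enum _) => [|i r [t' rt' et']].
    by exists (GRing.Const 1) => // v w s _; rewrite big_nil.
  exists (GRing.Mul (GRing.Exp (GRing.Var _ (N + i)) (u i)) t') => // v w s sw.
  rewrite big_cons /= (et' v w s sw) nth_cat size_env ltnNge leq_addr /=.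
  by rewrite addKn sw.
exists (GRing.Add (GRing.Mul (GRing.Const c) tu) t) => [|v w s sw].
  by rewrite /= rtu.
by rewrite /= (et v w s sw) (etu v w s sw) mevalD mevalZ mevalX.
Qed.

(** A weak form of Chevalley's theorem: the image of phi is described by an
    existential formula, which quantifier elimination makes quantifier-free. *)
Theorem generic_image m (phi : 'I_N -> {mpoly K[m]}) :
  exists2 p, p != 0 &
    (forall v, p.@[v] != 0 -> exists w, forall i, v i = (phi i).@[w]) \/
    (forall w, p.@[fun i => (phi i).@[w]] = 0).
Proof.
have /fin_all_exists[t /all_and2[rt et]] (i : 'I_N) :
    exists t : GRing.term K, GRing.rterm t /\
    forall v (w : 'I_m -> K) s, (forall j : 'I_m, s`_j = w j) ->
      GRing.eval (env v ++ s) t = (phi i).@[w].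
  by have [t rt et] := term_of_mpoly _ (phi i); exists t.
pose eqn (i : 'I_N) := GRing.Equal (GRing.Var _ i) (t i).
pose f := foldr (fun i => GRing.And (eqn i)) (GRing.Bool true) (enum 'I_N).
have rf : GRing.rformula f.
  by rewrite /f; elim: (enum _) => //= i r ->; rewrite rt.
have holds_f v s w : (forall j : 'I_m, s`_j = w j) ->
    (GRing.holds (env v ++ s) f <-> forall i, v i = (phi i).@[w]).
  move=> sw; have -> : (forall i, v i = (phi i).@[w]) <->
      (forall i, i \in enum 'I_N -> v i = (phi i).@[w]).
    by split=> H i; [move=> _|]; apply: H; rewrite ?mem_enum.
  rewrite /f; elim: (enum _) => [|i r IHr] /=; first by split.
  rewrite IHr (et i v w s sw) nth_cat size_env ltn_ord nth_env.
  split=> [[ei er] j|H]; first by rewrite inE => /predU1P[->|/er].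
  by split=> [|j jr]; apply: H; rewrite inE ?eqxx ?jr ?orbT.
pose F := foldr GRing.Exists f (iota N m).
have holds_F v :
    GRing.holds (env v) F <-> exists w, forall i, v i = (phi i).@[w].
  rewrite /F -{1}(size_env v); split.
    case/holds_exists_block => s sz ef; exists (fun i => s`_i).
    by apply: (holds_f v s _ (fun=> erefl)).1.
  case=> w ew; apply/holds_exists_block.
  exists [seq w i | i <- enum 'I_m]; first by rewrite size_map size_enum_ord.
  apply: (holds_f v _ w _).2 => // j.
  by rewrite (nth_map j) ?size_enum_ord // nth_ord_enum.
have [p p0 [yes|no]] : exists2 p, p != 0 &
    (forall v, p.@[v] != 0 -> GRing.holds (env v) F) \/
    (forall v, p.@[v] != 0 -> ~ GRing.holds (env v) F).
  by apply: generically_decided; rewrite /F; elim: (iota _ _).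
- by exists p => //; left => v /yes /holds_F.
- exists p => //; right => w; apply/eqP/negPn/negP => /no; apply.
  by apply/holds_F; exists w.
Qed.

End Constructible.

(** * Algebraic dependence *)

Section AlgebraicDependence.
Variable K : fieldType.

Lemma msizeM_bound m (p q : {mpoly K[m]}) a b :
  (msize p <= a.+1 -> msize q <= b.+1 -> msize (p * q) <= (a + b).+1)%N.
Proof.
have [->|p0] := eqVneq p 0; first by rewrite mul0r msize0.
have [->|q0] := eqVneq q 0; first by rewrite mulr0 msize0.
by rewrite msizeM //; move: (msize p) (msize q) => x y; lia.
Qed.

Lemma msize_monomial_bound N m (phi : 'I_N -> {mpoly K[m]})
    (u : 'I_N -> nat) d D :
    (forall i, msize (phi i) <= d.+1)%N -> (forall i, u i <= D)%N ->
  (msize (\prod_i phi i ^+ u i) <= (N * (d * D)).+1)%N.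
Proof.
move=> phi_d uD.
have exp_le i k : (k <= D)%N -> (msize (phi i ^+ k) <= (d * k).+1)%N.
  elim: k => [|k IHk] kD; first by rewrite expr0 msize1.
  by rewrite exprS mulnS; apply: msizeM_bound => //; apply: IHk; apply: ltnW.
rewrite -[N in (N * _)%N](card_ord N) -sum_nat_const.
elim/big_ind2: _ => [|a p b q|i _]; first by rewrite msize1.
  exact: msizeM_bound.
by apply: leq_trans (exp_le i _ (uD i)) _; rewrite ltnS leq_mul2l uD orbT.
Qed.

(** There are (D+1)^N monomials of degree at most D in each of N variables.
    Substituting phi sends them to polynomials in m variables with exponents
    below some B linear in D, hence into a space of dimension B^m.  As m < N,
    for large D this dimension is the smaller one, and a linear relation between the
    images is an algebraic relation between the phi i. *)
Theorem algebraic_dependence N m (phi : 'I_N -> {mpoly K[m]}) : (m < N)%N ->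
  exists2 p : {mpoly K[N]}, p != 0 & forall w, p.@[fun i => (phi i).@[w]] = 0.
Proof.
move=> mN; pose d := (\max_i msize (phi i))%N.
have phi_d i : (msize (phi i) <= d.+1)%N by apply: leqW; apply: leq_bigmax.
(* B <= (N d + 1) (D + 1), so that B ^ m <= D (D + 1) ^ m. *)
pose D := ((N * d).+1 ^ m)%N; pose B := (N * (d * D)).+1.
have D_gt0 : (0 < D)%N by rewrite expn_gt0.
have count : (B ^ m < D.+1 ^ N)%N.
  apply: (@leq_ltn_trans (D.+1 ^ m * D)).
    rewrite mulnC -expnMn.
    suff: (B <= (N * d).+1 * D.+1)%N by case: (m) => // j; rewrite leq_exp2r.
    by rewrite /B; nia.
  apply: (@leq_trans (D.+1 ^ m.+1)); last exact: leq_pexp2l.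
  by rewrite expnSr ltn_pmul2l ?expn_gt0.
pose rowT : finType := {ffun 'I_N -> 'I_D.+1}.
pose colT : finType := {ffun 'I_m -> 'I_B}.
pose mon (x : rowT) : {mpoly K[m]} := \prod_i phi i ^+ x i.
pose A := \matrix_(i < #|rowT|, j < #|colT|)
  (mon (enum_val i))@_[multinom (enum_val j k : nat) | k < m].
have : kermx A != 0.
  rewrite -mxrank_eq0 mxrank_ker -lt0n subn_gt0.
  apply: leq_ltn_trans (rank_leq_col A) _.
  by rewrite !card_ffun !card_ord.
case/rowV0Pn => u /sub_kermxP uA u0.
pose expo (x : rowT) := [multinom (x k : nat) | k < N].
have expo_inj : injective expo.
  move=> x y /mnmP eq_xy; apply/ffunP => k; apply/val_inj.
  by move: (eq_xy k); rewrite !mnmE.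
pose p : {mpoly K[N]} := \sum_i u 0 i *: 'X_[expo (enum_val i)].
have rel : \sum_i u 0 i *: mon (enum_val i) = 0.
  apply/mpolyP => mm; rewrite mcoeff0.
  have [small|] := boolP [forall k, mm k < B]%N.
    pose y : colT := [ffun k => inord (mm k)].
    move/rowP: uA => /(_ (enum_rank y)); rewrite !mxE => uA.
    rewrite raddf_sum -[RHS]uA.
    apply: eq_bigr => i _; rewrite mxE /= mcoeffZ enum_rankK; congr (_ * _@__).
    by apply/mnmP => k; rewrite mnmE ffunE inordK //; apply: (forallP small).
  rewrite negb_forall => /existsP[k]; rewrite -leqNgt => Bk.
  rewrite raddf_sum /= big1 // => i _; rewrite mcoeffZ memN_msupp_eq0 ?mulr0 //.
  apply: msize_mdeg_ge; apply: leq_trans (_ : mm k <= _)%N.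
    apply: leq_trans Bk; apply: msize_monomial_bound => // j.
    by rewrite -ltnS ltn_ord.
  by rewrite mdegE (bigD1 k) //= leq_addr.
exists p => [|w].
  have [i ui] : exists i, u 0 i != 0.
    apply/existsP; apply: contraNT u0; rewrite negb_exists => /forallP ui.
    by apply/eqP/rowP => i; rewrite mxE; apply/eqP; rewrite -[_ == _]negbK ui.
  apply: contraNneq ui => /(congr1 (mcoeff (expo (enum_val i)))).
  rewrite mcoeff0 raddf_sum /= (bigD1 i) //= big1.
    by rewrite addr0 mcoeffZ mcoeffX eqxx mulr1 => ->.
  move=> j neq_ij; rewrite mcoeffZ mcoeffX.
  by rewrite (inj_eq expo_inj) (inj_eq enum_val_inj) (negPf neq_ij) mulr0.
move/(congr1 (meval w)): rel; rewrite meval0 => <-; rewrite !raddf_sum /=.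
apply: eq_bigr => i _; rewrite !mevalZ mevalX rmorph_prod; congr (_ * _).
by apply: eq_bigr => k _; rewrite mnmE rmorphXn.
Qed.

End AlgebraicDependence.

(** * A matrix of corank k in general position with the diagonal matrices *)

Section Corank.
Variable K : fieldType.

Lemma rank_projector k n (Y : 'M[K]_(k, n)) (X : 'M[K]_(n, k)) :
  Y *m X = 1%:M -> (\rank (1%:M - X *m Y)%R <= n - k)%N.
Proof.
move=> YX; have /mulmx0_rank_max : (1%:M - X *m Y) *m X = 0.
  by rewrite mulmxBl mul1mx -mulmxA YX mulmx1 subrr.
have -> : \rank X = k.
  apply/eqP; rewrite eqn_leq rank_leq_col /=.
  by rewrite -[leqLHS](mxrank1 K k) -YX mxrankM_maxr.
by move=> le_n; rewrite leq_subRL ?(leq_trans _ le_n) ?leq_addl // addnC.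
Qed.

(** A is the projector along the image of X onto the kernel of Y, so that
    H = H A + H X Y and, as Y (H X Y) = 0, the projector A fixes H X Y. *)
Lemma tangent_projector k n (Y : 'M[K]_(k, n)) (X : 'M[K]_(n, k))
    (H : 'M[K]_n) :
    Y *m H *m X = 0 -> let A := 1%:M - X *m Y in
  H = H *m A + A *m (H *m X *m Y).
Proof.
move=> YHX A; rewrite /A mulmxBr mulmx1 mulmxBl mul1mx.
rewrite !mulmxA -[X *m Y *m H *m X](mulmxA _ H) -!(mulmxA X) (mulmxA Y).
by rewrite YHX mul0mx mulmx0 subr0 subrK.
Qed.

(** Y D X is the sum over i of d_i times the product of the i-th column of Y and
    the i-th row of X, so k^2 indices are used, one for each pair (a, b): the
    column of Y is the basis vector e_a, and the row of X is e_b if b != a and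
    e_a minus the other basis vectors if b = a.  For each a these rows form a
    basis, which gives surjectivity; their sum is e_a, which gives Y X = 1. *)
Lemma diagonal_sandwich_onto k n : (k * k <= n)%N ->
  exists (Y : 'M[K]_(k, n)) (X : 'M[K]_(n, k)),
    Y *m X = 1%:M /\
    forall T : 'M[K]_k, exists d : 'rV_n, Y *m diag_mx d *m X = T.
Proof.
move=> kk; have card_le : (#|{: 'I_k * 'I_k}| <= n)%N.
  by rewrite card_prod !card_ord.
pose pos (p : 'I_k * 'I_k) : 'I_n := widen_ord card_le (enum_rank p).
have pos_inj : injective pos.
  by move=> p q /(congr1 val) /= /val_inj /enum_rank_inj.
pose x (p : 'I_k * 'I_k) (c : 'I_k) : K :=
  if p.1 == p.2 then (if c == p.1 then 1 else -1) else (c == p.2)%:R.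
have pick_pos (F : 'I_k * 'I_k -> K) p :
    \sum_q (pos p == pos q)%:R * F q = F p.
  rewrite (bigD1 p) //= eqxx mul1r big1 ?addr0 // => q.
  by rewrite eq_sym (inj_eq pos_inj) => /negPf ->; rewrite mul0r.
pose Y : 'M[K]_(k, n) := \matrix_(a, i) \sum_b (i == pos (a, b))%:R.
pose X : 'M[K]_(n, k) := \matrix_(i, c) \sum_p (i == pos p)%:R * x p c.
have sandwich d : Y *m diag_mx d *m X =
    \matrix_(a, c) \sum_b d 0 (pos (a, b)) * x (a, b) c.
  apply/matrixP => a c; rewrite !mxE.
  under eq_bigr => i _ do rewrite mul_mx_diag !mxE !mulr_suml.
  rewrite exchange_big /=; apply: eq_bigr => b _.
  rewrite (bigD1 (pos (a, b))) //= eqxx mul1r pick_pos big1 ?addr0 //.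
  by move=> i /negPf ->; rewrite !mul0r.
have rowE (D : 'I_k * 'I_k -> K) a c : \sum_b D (a, b) * x (a, b) c =
    if c == a then D (a, a) else D (a, c) - D (a, a).
  rewrite (bigD1 a) //= {1}/x /= eqxx.
  have neqE b : b != a ->
      D (a, b) * x (a, b) c = if c == b then D (a, b) else 0.
    by rewrite /x /= eq_sym => /negPf ->; case: eqP; rewrite ?mulr1 ?mulr0.
  rewrite (eq_bigr _ neqE) -big_mkcondr /=; case: eqVneq => [->|neq_ca].
    rewrite mulr1 big1 ?addr0 // => b /andP[/negPf neq_ba /eqP eq_ab].
    by rewrite -eq_ab eqxx in neq_ba.
  rewrite (big_pred1 c) ?mulrN1 1?addrC // => b /=.
  by rewrite andbC [c == b]eq_sym; case: eqP => // ->.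
exists Y, X; split=> [|T].
  have -> : Y *m X = Y *m diag_mx (const_mx 1) *m X.
    by rewrite diag_const_mx mulmx1.
  rewrite sandwich; apply/matrixP => a c; rewrite !mxE.
  under eq_bigr => b _ do rewrite mxE.
  by rewrite (rowE (fun=> 1)) subrr eq_sym; case: eqP.
(* Inverts the formula of rowE for the entry (a, c) of the sandwich, which is
   D (a, c) - D (a, a) for c != a, and D (a, a) for c = a. *)
pose D (p : 'I_k * 'I_k) :=
  if p.1 == p.2 then T p.1 p.1 else T p.1 p.2 + T p.1 p.1.
exists (\row_i \sum_p (i == pos p)%:R * D p).
rewrite sandwich; apply/matrixP => a c; rewrite !mxE.
under eq_bigr => b _ do rewrite mxE pick_pos.
rewrite rowE /D /= eqxx; case: (eqVneq c a) => [->|_] //.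
by rewrite addrK.
Qed.

(** Given H, the diagonal matrix D = diag d is chosen with Y (H + D) X = 0. *)
Lemma transversal_corank k n : (k * k <= n)%N ->
  exists2 A : 'M[K]_n, (\rank A <= n - k)%N &
    forall H, exists d U V, H + diag_mx d = U *m A + A *m V.
Proof.
move=> /diagonal_sandwich_onto[Y [X [YX onto]]].
exists (1%:M - X *m Y) => [|H]; first exact: rank_projector.
have [d dE] := onto (- (Y *m H *m X)).
exists d, (H + diag_mx d), ((H + diag_mx d) *m X *m Y).
by apply: tangent_projector; rewrite mulmxDr mulmxDl dE subrr.
Qed.

(** * Matrices of a given rank *)

(** Zeroing the other rows, instead of extracting the rows in J, keeps the size
    of A and the indexing of its rows by 'I_n. *)
Definition keep_rows {n} (J : {set 'I_n}) (A : 'M[K]_n) : 'M_n :=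
  \matrix_(i, j) (if i \in J then A i j else 0).

Lemma rank_row_selection n (A : 'M[K]_n) :
  exists2 J : {set 'I_n}, #|J| = \rank A & exists C, A = C *m keep_rows J A.
Proof.
pose f := maxrankfun A; exists (f @: setT).
  by rewrite card_imset ?cardsT ?card_ord //; apply: maxrankfun_inj.
suff /submxP[C AC] : (A <= keep_rows (f @: setT) A)%MS by exists C.
apply: (@submx_trans _ _ _ _ _ _ (rowsub f A)); first by rewrite eq_maxrowsub.
apply/row_subP => i.
have -> : row i (rowsub f A) = row (f i) (keep_rows (f @: setT) A).
  by apply/rowP => j; rewrite !mxE imset_f.
exact: row_sub.
Qed.

End Corank.

Arguments keep_rows {K n} J A.

(** * Generic subsets of an affine space *)

Section Generic.
Variables (K : closedFieldType) (I : finType).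
Implicit Types (p : {mpoly K[#|I|]}) (x : {ffun I -> K}).

Lemma eval_at_ffun p (v : 'I_#|I| -> K) :
  eval_at p [ffun i => v (enum_rank i)] = p.@[v].
Proof. by apply: meval_eq => i; rewrite ffunE enum_valK. Qed.

Lemma eval_at_nonvanishing p : p != 0 -> exists x, eval_at p x != 0.
Proof.
case/mpoly_nonvanishing => v pv.
by exists [ffun i => v (enum_rank i)]; rewrite eval_at_ffun.
Qed.

Lemma nonvanishing_open p : zariski_open (fun x => eval_at p x != 0).
Proof.
exists (fun x => eval_at p x = 0) => [|x]; last by split=> /eqP.
by exists (fun q => q = p) => x; split=> [px q ->|]; last exact.
Qed.

Lemma open_contains_nonvanishing (U : {ffun I -> K} -> Prop) x :
    zariski_open U -> U x ->
  exists2 p, p != 0 & forall y, eval_at p y != 0 -> U y.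
Proof.
case=> Z [S ZS] UZ /UZ Zx.
have [p pS px] : exists2 p, S p & eval_at p x != 0.
  apply: contra_notP Zx => noS; apply/ZS => p pS.
  by apply/eqP/negPn/negP => px; apply: noS; exists p.
exists p => [|y py].
  by apply: contraNneq px => ->; rewrite /eval_at meval0.
by apply/UZ => /ZS /(_ p pS) /eqP; apply/negP.
Qed.

End Generic.

(** * Completions of the off-diagonal entries *)

Section Completions.
Variables (K : closedFieldType) (n : nat).
Notation E := (off_diagonal_graph n).
Notation edge := {e : 'I_n * 'I_n | e \in E}.

Lemma card_edge : #|{: edge}| = (n * n - n)%N.
Proof.
rewrite card_sig -[n in (_ - n)%N](card_ord n).
have /card_imset <- : injective (fun i : 'I_n => (i, i)) by move=> i j [].
rewrite -[n in (n * _)%N]card_ord -[n in (_ * n)%N]card_ord -card_prod.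
rewrite -(cardsC [set (i, i) | i in 'I_n]) addKn.
apply: eq_card => -[i j]; rewrite !inE /=; congr (~~ _).
apply/eqP/imsetP => [->|[l _ [-> ->]] //]; by exists j.
Qed.

(** The parameters are the entries of U and V in U A V, where A has rank at most
    n - k and is transversal to the diagonal matrices.  On the line
    (1 + t U, 1 + t V) this product is A + t (U A + A V) + t^2 U A V, whose
    linear term takes all off-diagonal values. *)
Lemma generic_low_rank_completion k : (k * k <= n)%N ->
  exists2 p : {mpoly K[#|{: edge}|]}, p != 0 &
    forall M : partial_matrix K E, eval_at p M != 0 ->
      exists2 A, completion M A & (\rank A <= n - k)%N.
Proof.
move=> /(transversal_corank K)[A rkA tangent].
pose par : finType := (('I_n * 'I_n) + ('I_n * 'I_n))%type.
pose mx_of (s : 'I_n * 'I_n -> par) (w : 'I_#|par| -> K) : 'M[K]_n :=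
  \matrix_(i, j) w (enum_rank (s (i, j))).
pose X (s : 'I_n * 'I_n -> par) : 'M[{mpoly K[#|par|]}]_n :=
  \matrix_(i, j) 'X_(enum_rank (s (i, j))).
pose offdiag (B : 'M[K]_n) (x : 'I_#|{: edge}|) : K :=
  B (val (enum_val x)).1 (val (enum_val x)).2.
pose phi (x : 'I_#|{: edge}|) : {mpoly K[#|par|]} :=
  (X inl *m map_mx (@mpolyC _ _) A *m X inr)
    (val (enum_val x)).1 (val (enum_val x)).2.
have phiE w x : (phi x).@[w] = offdiag (mx_of inl w *m A *m mx_of inr w) x.
  have Xw s : map_mx (meval w) (X s) = mx_of s w.
    by apply/matrixP => i j; rewrite !mxE mevalXU.
  have Aw : map_mx (meval w) (map_mx (@mpolyC _ _) A) = A.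
    by apply/matrixP => i j; rewrite !mxE mevalC.
  by rewrite /offdiag -!Xw -[in RHS]Aw -!map_mxM mxE.
have [p p0 [image|vanish]] := generic_image _ _ _ phi.
  exists p => // M /image[w Mw].
  exists (mx_of inl w *m A *m mx_of inr w).
    move=> e; have := Mw (enum_rank e).
    by rewrite phiE /offdiag enum_rankK => ->.
  by rewrite (leq_trans (mxrankM_maxl _ _)) // (leq_trans (mxrankM_maxr _ _)).
case: (@no_vanishing_on_submersion K _ p (offdiag A) p0) => v.
pose H : 'M[K]_n := \matrix_(i, j)
  if insub (i, j) is Some e then v (enum_rank (e : edge)) else 0.
have [d [U [V HUV]]] := tangent H.
exists (offdiag (U *m A *m V)) => t.
pose w (x : 'I_#|par|) := match enum_val x with
  | inl (i, j) => (1%:M + t *: U) i j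
  | inr (i, j) => (1%:M + t *: V) i j
  end.
rewrite -[RHS](vanish w); apply: meval_eq => x; rewrite phiE.
have -> : mx_of inl w = 1%:M + t *: U.
  by apply/matrixP => i j; rewrite mxE /w enum_rankK.
have -> : mx_of inr w = 1%:M + t *: V.
  by apply/matrixP => i j; rewrite mxE /w enum_rankK.
have -> : (1%:M + t *: U) *m A *m (1%:M + t *: V) =
    A + (t *: (H + diag_mx d) + t ^+ 2 *: (U *m A *m V)).
  rewrite HUV mulmxDl mul1mx -scalemxAl mulmxDr mulmx1 -scalemxAr mulmxDl.
  by rewrite -scalemxAl !scalerDr scalerA -expr2 !addrA.
have -> : v x = offdiag (H + diag_mx d) x.
  rewrite /offdiag !mxE.
  have := valP (enum_val x); rewrite inE => /negPf ->.
  by rewrite mulr0n addr0 -surjective_pairing valK enum_valK.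
by rewrite /offdiag !mxE.
Qed.

(** One polynomial is found for each possible set J of r basis rows.  The
    parameters are indexed by the positions (i, j) with i or j in J: for i in J
    the parameter is the entry (i, j) itself, and for i outside J it is the
    coefficient of row j in the expansion of row i. *)
Lemma generic_completion_outside_rank r : (n < (n - r) ^ 2)%N ->
  exists2 p : {mpoly K[#|{: edge}|]}, p != 0 &
    forall M A, completion M A -> \rank A = r -> eval_at p M = 0.
Proof.
move=> n_lt.
suff killed (J : {set 'I_n}) : exists p : {mpoly K[#|{: edge}|]}, p != 0 /\
    (#|J| = r -> forall M C A, completion M A -> A = C *m keep_rows J A ->
     eval_at p M = 0).
  have [p pP] := fin_all_exists killed.
  exists (\prod_J p J) => [|M A MA rA].
    by apply/prodf_neq0 => J _; case: (pP J).
  have [J cJ [C AC]] := rank_row_selection _ _ A.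
  have pJ := (pP J).2 (etrans cJ rA) M C A MA AC.
  by rewrite /eval_at rmorph_prod (bigD1 J) //= [X in X * _]pJ mul0r.
have [cJ|] := eqVneq #|J| r; last by move=> /eqP ?; exists 1; rewrite oner_eq0.
pose P : {set 'I_n * 'I_n} := [set e | (e.1 \in J) || (e.2 \in J)].
pose par : finType := {e : 'I_n * 'I_n | e \in P}.
have card_par : #|par| = (n * n - (n - r) ^ 2)%N.
  rewrite card_sig -[n in (n * _)%N]card_ord -[n in (_ * n)%N]card_ord.
  rewrite -card_prod; have <- : #|setX (~: J) (~: J)| = ((n - r) ^ 2)%N.
    by rewrite cardsX cardsCs setCK card_ord cJ.
  rewrite -(cardsC (setX (~: J) (~: J))) addKn; apply: eq_card => -[i j].
  by rewrite !inE /= negb_and !negbK.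
pose var i j : {mpoly K[#|par|]} :=
  if insub (i, j) is Some x then 'X_(enum_rank (x : par)) else 0.
pose phi (k : 'I_#|{: edge}|) : {mpoly K[#|par|]} :=
  let: (i, j) := val (enum_val k) in
  if i \in J then var i j else \sum_(l in J) var i l * var l j.
have small : (#|par| < #|{: edge}|)%N.
  rewrite card_par card_edge ltn_sub2l //.
  apply: leq_trans n_lt _; rewrite -mulnn; apply: leq_mul; exact: leq_subr.
have [p p0 p_phi] := algebraic_dependence K _ _ phi small.
exists p; split=> // _ M C A MA AC.
pose w (k : 'I_#|par|) := let: (i, j) := val (enum_val k) in
  if i \in J then A i j else C i j.
have varE i j : (i \in J) || (j \in J) ->
    (var i j).@[w] = if i \in J then A i j else C i j.
  move=> ijP; rewrite /var insubT ?inE // => ijP'.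
  by rewrite mevalXU /w enum_rankK.
rewrite -[RHS](p_phi w); apply: meval_eq => k; rewrite -MA /phi.
case: (val (enum_val k)) => i j /=; case: ifP => iJ; first by rewrite varE iJ.
rewrite {1}AC mxE raddf_sum /= [RHS]big_mkcond; apply: eq_bigr => l _.
rewrite mxE; case: ifP => lJ; last by rewrite mulr0.
by rewrite mevalM !varE ?lJ ?orbT // iJ.
Qed.

Lemma generic_rank_unique r s :
    generically_completion_rank K E r -> generically_completion_rank K E s ->
  r = s.
Proof.
move=> [U [openU [M UM] rkU]] [V [openV [L VL] rkV]].
have [p p0 pU] := open_contains_nonvanishing _ _ _ _ openU UM.
have [q q0 qV] := open_contains_nonvanishing _ _ _ _ openV VL.
have [x] : exists x, eval_at (p * q) x != 0.
  by apply: eval_at_nonvanishing; rewrite mulf_neq0.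
rewrite /eval_at mevalM mulf_eq0 negb_or => /andP[/pU /rkU[[A xA <-] minr]].
move=> /qV /rkV[[B xB <-] mins].
by apply/eqP; rewrite eqn_leq minr // mins.
Qed.

Theorem generic_rank_off_diagonal k : (k * k <= n)%N -> (n < k.+1 ^ 2)%N ->
  is_generic_completion_rank K E (n - k).
Proof.
move=> k2n nk2; suff gen : generically_completion_rank K E (n - k).
  by split=> // r; exact: generic_rank_unique.
have [p p0 lowP] := generic_low_rank_completion k k2n.
have /fin_all_exists[q qP] (r : 'I_(n - k)) : exists q : {mpoly K[#|{: edge}|]},
    q != 0 /\ forall M A, completion M A -> \rank A = r -> eval_at q M = 0.
  have [|q q0 qr] := generic_completion_outside_rank r; last by exists q.
  by apply: leq_trans nk2 _; rewrite leq_sqr; have := ltn_ord r; lia.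
pose g := p * \prod_r q r.
have g0 : g != 0.
  by rewrite mulf_neq0 //; apply/prodf_neq0 => r _; case: (qP r).
exists (fun M => eval_at g M != 0); split.
- exact: nonvanishing_open.
- exact: eval_at_nonvanishing.
move=> M; rewrite /eval_at mevalM mulf_eq0 negb_or => /andP[/lowP[A MA rkA]].
rewrite rmorph_prod /= => /prodf_neq0 qM.
have lower B : completion M B -> (n - k <= \rank B)%N.
  move=> MB; rewrite leqNgt; apply/negP => rB.
  have [_ /(_ M B MB erefl) qB] := qP (Ordinal rB).
  by have := qM (Ordinal rB) isT; rewrite [X in X != 0]qB eqxx.
split=> //; exists A => //.
by apply/eqP; rewrite eqn_leq rkA lower.
Qed.

End Completions.

Theorem proposition5p7 (R : realType) (n : nat) (n_gt0 : (0 < n)%N) :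
  is_generic_completion_rank R[i] (off_diagonal_graph n)
    (n - Num.truncn (Num.sqrt (n%:R : R)))%N.
Proof.
have /andP[] := truncn_itv (sqrtr_ge0 (n%:R : R)).
set k := Num.truncn _ => k_le k_gt.
have sqrt2 : Num.sqrt (n%:R : R) ^+ 2 = n%:R by rewrite sqr_sqrtr ?ler0n.
apply: (generic_rank_off_diagonal (R[i] : closedFieldType)).
  by rewrite mulnn -(ler_nat R) natrX -sqrt2 lerXn2r // ?nnegrE ?ler0n ?sqrtr_ge0.
by rewrite -(ltr_nat R) natrX -sqrt2 ltrXn2r // ?nnegrE ?ler0n ?sqrtr_ge0.
Qed.
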